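(* $K_G^{+,\mathbb{R}}(3)=\frac{9}{8}$, where $$K_G^{+,\mathbb{R}}(3):=\sup\Big\{\Big|\sum_{i,j=1}^3 b_{ij}\langle x_i,x_j\rangle\Big| : B=(b_{ij})\in M_3(\mathbb{R}),\ B\geq 0,\ \|B\|_{\infty\to 1}\leq 1,\ \|x_i\|\leq 1\ (1\le i\le 3)\Big\},$$ and the vectors $x_1,x_2,x_3$ range over arbitrary real Hilbert spaces.
   Context: $B\ge 0$ means that $B$ is a real symmetric non-negative definite matrix. For $B\in M_n(\mathbb{R})$, $\|B\|_{\infty\to 1}$ is the operator norm of $B$ as a map from $\ell_\infty^n(\mathbb{R})$ to $\ell_1^n(\mathbb{R})$ (canonical basis). The number $K_G^{+,\mathbb{R}}(n)$ is called the (real) positive Grothendieck constant of order $n$. *)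

(* Defs.v *)
From HB Require Import structures.
From mathcomp Require Import all_boot all_order all_algebra sesquilinear.
From mathcomp Require Import all_classical all_reals all_analysis.
Set Implicit Arguments.
Unset Strict Implicit.
Unset Printing Implicit Defensive.
Import Order.TTheory GRing.Theory Num.Theory numFieldNormedType.Exports.
Local Open Scope classical_set_scope.
Local Open Scope ring_scope.

(* With idfun as the conjugation, {dot _ for idfun} is the type of real symmetric
   positive definite bilinear forms. *)
Record hilbertSpace (R : realType) := HilbertSpace {
  hilbert_sort :> completeNormedModType R;
  inner : {dot hilbert_sort for idfun};
  inner_norm : forall x : hilbert_sort, inner x x = `|x| ^+ 2 }.

Definition nonneg_definite (R : realType) (n : nat) (B : 'M[R]_n) : Prop :=
  B^T = B /\ forall u : 'cV[R]_n, 0 <= (u^T *m B *m u) 0 0.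

Definition l1norm (R : realType) (n : nat) (u : 'cV[R]_n) : R :=
  \sum_(i < n) `|u i 0|.

(* The norm `|u| of MathComp-Analysis on matrices is the sup norm; the set is
   nonempty and bounded, so this real-valued supremum is the genuine one. *)
Definition opnorm_infty_1 (R : realType) (n : nat) (B : 'M[R]_n) : R :=
  sup [set l1norm (B *m u) | u in [set u : 'cV[R]_n | `|u| <= 1]].

Definition KG_pos (R : realType) (n : nat) : \bar R :=
  ereal_sup [set a : \bar R |
    exists (B : 'M[R]_n) (H : hilbertSpace R) (x : 'I_n -> H),
      [/\ nonneg_definite B, opnorm_infty_1 B <= 1, forall i, `|x i| <= 1
        & a = (`| \sum_(i < n) \sum_(j < n) B i j * inner H (x i) (x j) |)%:E]].

(* Main.v *)
(* For B >= 0 the norm of B from l_infty to l_1 dominates s^T B s for every sign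
   vector s, so by symmetry it is enough to bound the pairing of B with the Gram
   matrix of the x_i, assuming that B has off-diagonal entries -p, -q, -r with
   0 <= p <= q, r; let D be its trace.
   - If 1/p >= 1/q + 1/r, the pairing is at most D + 2(q + r - p), the value of
     B at a sign vector.
   - Otherwise |qr x_1 + pr x_2 + pq x_3|^2 >= 0 bounds the pairing by
     D + qr/p + pr/q + pq/r.  Since B >= 0 at (1, 1, 1) gives
     D >= 2(p + q + r), this is at most 9/8 (D + 2(q + r - p)): with
     alpha = qr and sigma = pr + pq the difference has the sign of
     (2 alpha - sigma)(2 sigma - alpha).
   The value 9/8 is attained by B = (3 I - J)/8, J the all-ones matrix, and three
   unit vectors of the plane at mutual angles 2 pi/3. *)
From HB Require Import structures.
Require Import Defs.
From mathcomp Require Import all_boot all_order all_algebra.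
From mathcomp Require Import all_classical all_reals all_analysis.
From mathcomp Require Import sesquilinear ring lra.
Import Order.TTheory GRing.Theory Num.Theory numFieldNormedType.Exports.
Local Open Scope classical_set_scope.
Local Open Scope ring_scope.

(** * Quadratic forms in three variables and the 9/8 inequality *)

Section ternary_forms.
Context {R : realFieldType}.
Implicit Types a b c d p q r u v w x y z : R.

(* The symmetric matrices [[a, z, y], [z, b, x], [y, x, c]]: x is the entry
   opposite to a, and so on. *)
Definition qform3 a b c x y z u v w : R :=
  a * u ^+ 2 + b * v ^+ 2 + c * w ^+ 2
  + (x * (v * w) + y * (u * w) + z * (u * v)) *+ 2.

Definition psd3 a b c x y z := forall u v w, 0 <= qform3 a b c x y z u v w.

(** The Frobenius pairing of two symmetric matrices, that is, the trace of their product. *)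
Definition trace3 a b c x y z a' b' c' x' y' z' : R :=
  a * a' + b * b' + c * c' + (x * x' + y * y' + z * z') *+ 2.

(** For b > 0, b times the pairing is the second form at (b, x) plus (b c - x^2) c'. *)
Lemma trace2_ge0 b c x b' c' x' :
  (forall v w, 0 <= b * v ^+ 2 + c * w ^+ 2 + x * (v * w) *+ 2) ->
  (forall v w, 0 <= b' * v ^+ 2 + c' * w ^+ 2 + x' * (v * w) *+ 2) ->
  0 <= b * b' + c * c' + x * x' *+ 2.
Proof.
move=> B G.
have b0 : 0 <= b by have := B 1 0; lra.
have c0 : 0 <= c by have := B 0 1; lra.
have [bN|bP] := leP b 0.
  have b00 : b = 0 by lra.
  have x0 : x = 0.
    apply/eqP; apply: contraT => x0.
    (* With b = 0 the form is affine in v at w = 1; this v gives it the value -1. *)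
    have := B (- (c + 1) / (x *+ 2)) 1.
    rewrite b00 [X in 0 <= X](_ : _ = -1); first by lra.
    by field; rewrite x0.
  have := G 0 1; rewrite b00 x0; nra.
have det : 0 <= b * c - x ^+ 2.
  have := B (- x / b) 1.
  rewrite -(pmulr_rge0 _ bP) [X in 0 <= X](_ : _ = b * c - x ^+ 2) //.
  by field; apply: lt0r_neq0.
rewrite -(pmulr_rge0 _ bP).
have := G b x; have c'0 : 0 <= c' by have := G 0 1; lra.
have := mulr_ge0 det c'0; lra.
Qed.

(** Reduction to order 2 by a Schur complement: for a > 0, a times the pairing is the second form at
    (a, z, y) plus the pairing of a times the Schur complement of a with the lower block (b', c',
    x'). *)
Lemma trace3_ge0 a b c x y z a' b' c' x' y' z' :
  psd3 a b c x y z -> psd3 a' b' c' x' y' z' ->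
  0 <= trace3 a b c x y z a' b' c' x' y' z'.
Proof.
rewrite /psd3 /qform3 /trace3 => B G.
have a0 : 0 <= a by have := B 1 0 0; lra.
have G' v w : 0 <= b' * v ^+ 2 + c' * w ^+ 2 + x' * (v * w) *+ 2.
  by have := G 0 v w; lra.
have [aN|aP] := leP a 0.
  have a00 : a = 0 by lra.
  have y0 : y = 0.
    apply/eqP; apply: contraT => y0.
    have := B (- (c + 1) / (y *+ 2)) 0 1.
    rewrite a00 [X in 0 <= X](_ : _ = -1); first by lra.
    by field; rewrite y0.
  have z0 : z = 0.
    apply/eqP; apply: contraT => z0.
    have := B (- (b + 1) / (z *+ 2)) 1 0.
    rewrite a00 [X in 0 <= X](_ : _ = -1); first by lra.
    by field; rewrite z0.
  rewrite a00 y0 z0 !mul0r add0r !addr0.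
  by apply: trace2_ge0 G' => v w; have := B 0 v w; lra.
rewrite -(pmulr_rge0 _ aP).
have := G a z y.
have S v w : 0 <= (a * b - z ^+ 2) * v ^+ 2 + (a * c - y ^+ 2) * w ^+ 2
    + (a * x - y * z) * (v * w) *+ 2.
  (* This first coordinate minimises the form for fixed v, w; a times the minimum is the form of
     [S]. *)
  have := B (- (z * v + y * w) / a) v w.
  rewrite -(pmulr_rge0 _ aP).
  congr (is_true (0 <= _)); field; exact: lt0r_neq0.
have := trace2_ge0 _ _ _ _ _ _ S G'; lra.
Qed.

Lemma trace3_le_neg d1 d2 d3 p q r a b c x y z :
  0 <= p -> p <= q -> p <= r ->
  0 <= d1 -> 0 <= d2 -> 0 <= d3 ->
  0 <= d1 + d2 + d3 - (p + q + r) *+ 2 ->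
  d1 + d2 + d3 + (q + r - p) *+ 2 <= 1 ->
  psd3 a b c x y z -> a <= 1 -> b <= 1 -> c <= 1 ->
  trace3 d1 d2 d3 (- p) (- q) (- r) a b c x y z <= 9 / 8.
Proof.
rewrite /psd3 /qform3 /trace3 => p0 pq pr d10 d20 d30 D0 D1 G a1 b1 c1.
have da : d1 * a <= d1 by rewrite ler_piMr.
have db : d2 * b <= d2 by rewrite ler_piMr.
have dc : d3 * c <= d3 by rewrite ler_piMr.
have x1 : x <= 1 by have := G 0 1 (-1); lra.
have y1 : - y <= 1 by have := G 1 0 1; lra.
have z1 : - z <= 1 by have := G 1 1 0; lra.
have x1' : - x <= 1 by have := G 0 1 1; lra.
have [cut|ell] := leP (p * (q + r)) (q * r).
  suff : - (p * x + q * y + r * z) <= q + r - p by lra.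
  have [qr0|qr0] := leP (q + r) 0.
    have [-> [-> ->]] : p = 0 /\ q = 0 /\ r = 0 by lra.
    lra.
  rewrite -(ler_pM2l qr0).
  (* The vector (q + r, r, q) is orthogonal to the sign vector (-1, 1, 1), whose Gram matrix is the
     extremal one in this case. *)
  have := G (q + r) r q.
  have : 0 <= (q * r - p * (q + r)) * (1 - x).
    by apply: mulr_ge0; lra.
  have : 0 <= (q + r) ^+ 2 * (1 - a) by apply: mulr_ge0; [exact: sqr_ge0 | lra].
  have : 0 <= r ^+ 2 * (1 - b) by apply: mulr_ge0; [exact: sqr_ge0 | lra].
  have : 0 <= q ^+ 2 * (1 - c) by apply: mulr_ge0; [exact: sqr_ge0 | lra].
  lra.
have p1 : 0 < p.
  rewrite lt_def p0 andbT; apply: contraTneq ell => ->.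
  by rewrite mul0r -leNgt mulr_ge0; lra.
have pqr : 0 < p * q * r by rewrite !mulr_gt0; lra.
rewrite -subr_ge0 -(pmulr_rge0 _ pqr).
have := G (q * r) (p * r) (p * q).
have : 0 <= (q * r) ^+ 2 * (1 - a) by rewrite mulr_ge0 ?sqr_ge0; lra.
have : 0 <= (p * r) ^+ 2 * (1 - b) by rewrite mulr_ge0 ?sqr_ge0; lra.
have : 0 <= (p * q) ^+ 2 * (1 - c) by rewrite mulr_ge0 ?sqr_ge0; lra.
have : 0 <= p * q * r * (d1 + d2 + d3 - (d1 * a + d2 * b + d3 * c)).
  by rewrite mulr_ge0; lra.
have : 0 <= p * q * r * (d1 + d2 + d3 - (p + q + r) *+ 2).
  by rewrite mulr_ge0; lra.
have : 0 <= p * q * r * (1 - (d1 + d2 + d3 + (q + r - p) *+ 2)).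
  by rewrite mulr_ge0; lra.
(* The first factor is q (r - p) + r (q - p); the second is positive since q r < p (q + r) here. The
   final combination takes half of this product, 9/8 of the sign vector bound and 1/8 of the bound
   at (1, 1, 1). *)
have : 0 <= (q * r *+ 2 - p * (q + r)) * (p * (q + r) *+ 2 - q * r).
  have : 0 <= q * (r - p) by rewrite mulr_ge0; lra.
  have : 0 <= r * (q - p) by rewrite mulr_ge0; lra.
  by move=> ? ?; rewrite mulr_ge0; lra.
lra.
Qed.

(** Permuting the coordinates of both matrices brings the off-diagonal entry of least absolute value
    to the place of -p in [trace3_le_neg]. *)
Lemma trace3_le_nonpos d1 d2 d3 b1 b2 b3 a b c x y z :
  psd3 d1 d2 d3 b1 b2 b3 -> b1 <= 0 -> b2 <= 0 -> b3 <= 0 ->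
  qform3 d1 d2 d3 b1 b2 b3 (-1) 1 1 <= 1 ->
  qform3 d1 d2 d3 b1 b2 b3 1 (-1) 1 <= 1 ->
  qform3 d1 d2 d3 b1 b2 b3 1 1 (-1) <= 1 ->
  psd3 a b c x y z -> a <= 1 -> b <= 1 -> c <= 1 ->
  trace3 d1 d2 d3 b1 b2 b3 a b c x y z <= 9 / 8.
Proof.
rewrite /qform3 => B b10 b20 b30 s1 s2 s3 G a1 b1' c1.
have := B 1 1 1; have := B 1 0 0; have := B 0 1 0; have := B 0 0 1.
rewrite /qform3 => d3' d2' d1' D.
have max1 : b2 <= b1 -> b3 <= b1 -> trace3 d1 d2 d3 b1 b2 b3 a b c x y z <= 9 / 8.
  move=> b21 b31; have := @trace3_le_neg d1 d2 d3 (- b1) (- b2) (- b3) a b c x y z.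
  by rewrite !opprK; apply=> //; lra.
have max2 : b1 <= b2 -> b3 <= b2 -> trace3 d1 d2 d3 b1 b2 b3 a b c x y z <= 9 / 8.
  move=> b12 b32; have := @trace3_le_neg d2 d1 d3 (- b2) (- b1) (- b3) b a c y x z.
  rewrite !opprK /trace3 => le.
  suff : d2 * b + d1 * a + d3 * c + (b2 * y + b1 * x + b3 * z) *+ 2 <= 9 / 8 by lra.
  by apply: le => //; first [lra | move=> u v w; have := G v u w; rewrite /qform3; lra].
have max3 : b1 <= b3 -> b2 <= b3 -> trace3 d1 d2 d3 b1 b2 b3 a b c x y z <= 9 / 8.
  move=> b13 b23; have := @trace3_le_neg d3 d2 d1 (- b3) (- b2) (- b1) c b a z y x.
  rewrite !opprK /trace3 => le.
  suff : d3 * c + d2 * b + d1 * a + (b3 * z + b2 * y + b1 * x) *+ 2 <= 9 / 8 by lra.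
  by apply: le => //; first [lra | move=> u v w; have := G w v u; rewrite /qform3; lra].
have [b12|/ltW b21] := leP b1 b2.
  by have [b23|/ltW b32] := leP b2 b3; [apply: max3; lra | exact: max2].
by have [b13|/ltW b31] := leP b1 b3; [apply: max3; lra | exact: max1].
Qed.

Lemma normr_offdiag_le1 a b c x y z :
  psd3 a b c x y z -> a <= 1 -> b <= 1 -> c <= 1 ->
  [/\ `|x| <= 1, `|y| <= 1 & `|z| <= 1].
Proof.
rewrite /psd3 /qform3 => G a1 b1 c1.
have := (G 0 1 1, G 0 1 (-1), (G 1 0 1, G 1 0 (-1)), (G 1 1 0, G 1 (-1) 0)).
by move=> [[[? ?] [? ?]] [? ?]]; split; rewrite ler_norml; lra.
Qed.

(** Up to a global sign, the four vectors tested are all the sign vectors. Negating one coordinate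
    in both matrices keeps the pairing and permutes these four, while changing the sign of two of x,
    y, z. *)
Lemma trace3_le a b c x y z a' b' c' x' y' z' :
  psd3 a b c x y z ->
  qform3 a b c x y z 1 1 1 <= 1 -> qform3 a b c x y z (-1) 1 1 <= 1 ->
  qform3 a b c x y z 1 (-1) 1 <= 1 -> qform3 a b c x y z 1 1 (-1) <= 1 ->
  psd3 a' b' c' x' y' z' -> a' <= 1 -> b' <= 1 -> c' <= 1 ->
  trace3 a b c x y z a' b' c' x' y' z' <= 9 / 8.
Proof.
move=> B s0 s1 s2 s3 G a'1 b'1 c'1.
have [x'1 y'1 z'1] := normr_offdiag_le1 _ _ _ _ _ _ G a'1 b'1 c'1.
have xx : x * x' <= `|x| by rewrite (le_trans (ler_norm _)) // normrM ler_piMr.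
have yy : y * y' <= `|y| by rewrite (le_trans (ler_norm _)) // normrM ler_piMr.
have zz : z * z' <= `|z| by rewrite (le_trans (ler_norm _)) // normrM ler_piMr.
have a0 : 0 <= a by have := B 1 0 0; rewrite /qform3; lra.
have b0 : 0 <= b by have := B 0 1 0; rewrite /qform3; lra.
have c0 : 0 <= c by have := B 0 0 1; rewrite /qform3; lra.
have aa : a * a' <= a by rewrite ler_piMr.
have bb : b * b' <= b by rewrite ler_piMr.
have cc : c * c' <= c by rewrite ler_piMr.
(* If x y z >= 0, the sign vector s making all terms x s2 s3, y s1 s3, z s1 s2
   nonnegative already gives the bound 1; otherwise flipping one sign makes
   x, y, z nonpositive. *)
have flip1 := trace3_le_nonpos a b c x (- y) (- z) a' b' c' x' (- y') (- z').
have flip2 := trace3_le_nonpos a b c (- x) y (- z) a' b' c' (- x') y' (- z').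
have flip3 := trace3_le_nonpos a b c (- x) (- y) z a' b' c' (- x') (- y') z'.
have B1 : psd3 a b c x (- y) (- z).
  by move=> u v w; have := B (- u) v w; rewrite /qform3; lra.
have B2 : psd3 a b c (- x) y (- z).
  by move=> u v w; have := B u (- v) w; rewrite /qform3; lra.
have B3 : psd3 a b c (- x) (- y) z.
  by move=> u v w; have := B u v (- w); rewrite /qform3; lra.
have G1 : psd3 a' b' c' x' (- y') (- z').
  by move=> u v w; have := G (- u) v w; rewrite /qform3; lra.
have G2 : psd3 a' b' c' (- x') y' (- z').
  by move=> u v w; have := G u (- v) w; rewrite /qform3; lra.
have G3 : psd3 a' b' c' (- x') (- y') z'.
  by move=> u v w; have := G u v (- w); rewrite /qform3; lra.
have same := trace3_le_nonpos _ _ _ _ _ _ _ _ _ _ _ _ B.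
rewrite /trace3 !mulrNN in flip1 flip2 flip3 same *.
have [x0|/ltW x0] := leP x 0; have [y0|/ltW y0] := leP y 0;
  have [z0|/ltW z0] := leP z 0.
- exact: same.
- move: xx yy zz s3; rewrite /qform3 !(ler0_norm x0, ler0_norm y0, ger0_norm z0); lra.
- move: xx yy zz s2; rewrite /qform3 !(ler0_norm x0, ler0_norm z0, ger0_norm y0); lra.
- by apply: flip1 => //; move: s0 s1 s2 s3; rewrite /qform3; lra.
- move: xx yy zz s1; rewrite /qform3 !(ler0_norm y0, ler0_norm z0, ger0_norm x0); lra.
- by apply: flip2 => //; move: s0 s1 s2 s3; rewrite /qform3; lra.
- by apply: flip3 => //; move: s0 s1 s2 s3; rewrite /qform3; lra.
- move: xx yy zz s0; rewrite /qform3 !(ger0_norm x0, ger0_norm y0, ger0_norm z0); lra.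
Qed.

End ternary_forms.

(** * The Euclidean plane as a Hilbert space *)

Section euclidean_plane.
Context {R : realType}.

(** The product itself carries the maximum norm; under a new name, with only the module structure
    copied, it can receive the Euclidean one. *)
Definition plane : Type := (R^o * R^o)%type.

HB.instance Definition _ := GRing.Lmodule.copy plane (R^o * R^o)%type.

Implicit Types x y : plane.

Definition plane_dot x y : R := x.1 * y.1 + x.2 * y.2.

Definition plane_norm x : R := Num.sqrt (plane_dot x x).

Lemma plane_dot_ge0 x : 0 <= plane_dot x x.
Proof. by rewrite addr_ge0 // -expr2 sqr_ge0. Qed.

Lemma plane_norm_sqr x : plane_norm x ^+ 2 = plane_dot x x.
Proof. exact/sqr_sqrtr/plane_dot_ge0. Qed.

Lemma plane_normD x y : plane_norm (x + y) <= plane_norm x + plane_norm y.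
Proof.
rewrite -(@ler_pXn2r _ 2) ?nnegrE ?addr_ge0 ?sqrtr_ge0 //.
rewrite sqrrD !plane_norm_sqr -subr_ge0.
have -> : plane_dot x x + plane_norm x * plane_norm y *+ 2 + plane_dot y y
    - plane_dot (x + y) (x + y)
    = (plane_norm x * plane_norm y - plane_dot x y) *+ 2.
  rewrite /plane_dot /=; ring.
rewrite mulrn_wge0 // subr_ge0 /plane_norm -sqrtrM ?plane_dot_ge0 //.
apply: le_trans (ler_norm _) _; rewrite -sqrtr_sqr ler_wsqrtr //.
(* Cauchy-Schwarz by Lagrange's identity: the defect is the square of a determinant. *)
rewrite -subr_ge0 /plane_dot.
by rewrite [X in 0 <= X](_ : _ = (x.1 * y.2 - x.2 * y.1) ^+ 2) ?sqr_ge0 //; ring.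
Qed.

Lemma plane_normZ (a : R) x : plane_norm (a *: x) = `|a| * plane_norm x.
Proof.
rewrite /plane_norm -sqrtr_sqr -sqrtrM ?sqr_ge0 //; congr Num.sqrt.
rewrite /plane_dot /= /GRing.scale /=; ring.
Qed.

Lemma plane_norm0_eq0 x : plane_norm x = 0 -> x = 0.
Proof.
move=> /(congr1 (fun t => t ^+ 2)); rewrite plane_norm_sqr expr0n /= /plane_dot.
rewrite -!expr2 => /eqP; rewrite paddr_eq0 ?sqr_ge0 // !sqrf_eq0.
by case: x => a b /= /andP[/eqP -> /eqP ->].
Qed.

HB.instance Definition _ :=
  Lmodule_isNormed.Build R plane plane_normD plane_normZ plane_norm0_eq0.

Lemma plane_normE x : `|x| = plane_norm x. Proof. by []. Qed.

Lemma normr_fst_le x : `|x.1| <= `|x|.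
Proof.
by rewrite plane_normE -sqrtr_sqr ler_wsqrtr // /plane_dot -!expr2 lerDl sqr_ge0.
Qed.

Lemma normr_snd_le x : `|x.2| <= `|x|.
Proof.
by rewrite plane_normE -sqrtr_sqr ler_wsqrtr // /plane_dot -!expr2 lerDr sqr_ge0.
Qed.

Lemma plane_norm_le_sum x : `|x| <= `|x.1| + `|x.2|.
Proof.
rewrite -(@ler_pXn2r _ 2) ?nnegrE ?addr_ge0 //.
rewrite plane_normE plane_norm_sqr /plane_dot sqrrD -!expr2 !real_normK ?num_real //.
by rewrite lerD2r lerDl mulrn_wge0 // mulr_ge0.
Qed.

(** Both coordinates are 1-Lipschitz, so they send a Cauchy filter to convergent ones; the two
    limits combine because the norm is at most the sum of the absolute coordinates. *)
Lemma plane_complete (F : set_system plane) :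
  ProperFilter F -> cauchy F -> cvg F.
Proof.
move=> FF /cauchyP Fc.
have coord (f : plane -> R) : (forall x y, `|f x - f y| <= `|x - y|) ->
    cvg (f @ F).
  move=> f1; apply: cauchy_cvg; apply: cauchy_exP => e e0.
  have [x Fx] := Fc e e0; exists (f x).
  suff : F [set y | ball (f x) e (f y)] by [].
  by apply: filterS Fx => y; rewrite -!ball_normE /=; exact: le_lt_trans.
have /cvg_ex[a Fa] : cvg ((fun x : plane => x.1 : R) @ F).
  by apply: coord => x y; apply: normr_fst_le (x - y).
have /cvg_ex[b Fb] : cvg ((fun x : plane => x.2 : R) @ F).
  by apply: coord => x y; apply: normr_snd_le (x - y).
apply/cvg_ex; exists ((a, b) : plane).
apply/cvgrPdist_lt => e e0.
have e20 : 0 < e / 2 by rewrite divr_gt0.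
move/cvgrPdist_lt : Fa => /(_ _ e20) Fa.
move/cvgrPdist_lt : Fb => /(_ _ e20) Fb.
near=> x.
apply: le_lt_trans (plane_norm_le_sum _) _; rewrite [e]splitr ltrD //=.
  by near: x.
by near: x.
Unshelve. all: by end_near. Qed.

HB.instance Definition _ := Uniform_isComplete.Build plane plane_complete.

Lemma plane_dot_bilinear :
  bilinear_for (GRing.Scale.Law.clone _ _ ( *%R ) _)
    (GRing.Scale.Law.clone _ _ (idfun \; *%R) _) plane_dot.
Proof.
split=> [u a v w|u a v w]; rewrite /plane_dot /= /GRing.scale /=; ring.
Qed.

HB.instance Definition _ := bilinear_isBilinear.Build R plane plane R
  _ _ plane_dot plane_dot_bilinear.

Lemma plane_dot_hermitian x y : plane_dot x y = (-1) ^+ false * idfun (plane_dot y x).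
Proof. rewrite /plane_dot /=; ring. Qed.

HB.instance Definition _ :=
  isHermitianSesquilinear.Build R plane false idfun plane_dot plane_dot_hermitian.

Lemma plane_dot_gt0 x : x != 0 -> 0 < plane_dot x x.
Proof.
rewrite -plane_norm_sqr -plane_normE => x0.
by rewrite exprn_gt0 // normr_gt0.
Qed.

HB.instance Definition _ := isDotProduct.Build R plane plane_dot plane_dot_gt0.

Definition euclidean_plane : hilbertSpace R :=
  @HilbertSpace R plane plane_dot (fun x => esym (plane_norm_sqr x)).

End euclidean_plane.

Lemma big_ord3 (V : nmodType) (F : 'I_3 -> V) :
  \sum_(i < 3) F i = F 0 + F 1 + F 2.
Proof.
rewrite !big_ord_recl big_ord0 addr0 addrA.
by congr (_ + F _ + F _); apply: val_inj.
Qed.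

(** * Quadratic forms against the norm from l_infty to l_1 *)

Section cut_norm.
Context {R : realType} {n : nat}.
Implicit Types (B : 'M[R]_n) (u : 'cV[R]_n).

Lemma cV_norm_leP u (M : R) : 0 <= M ->
  `|u| <= M <-> forall i, `|u i 0| <= M.
Proof.
move=> M0; rewrite [`|u|]mx_normrE; split.
  by move=> /bigmax_leP[_ uM] i; exact: (uM (i, 0)).
by move=> uM; apply/bigmax_leP; split=> // -[i j] _ /=; rewrite ord1.
Qed.

Lemma normr_entry_le1 u i : `|u| <= 1 -> `|u i 0| <= 1.
Proof. by move=> /cV_norm_leP; apply. Qed.

(** Boundedness ensures that the real [sup] defining [opnorm_infty_1] is an upper bound of its
    set. *)
Lemma has_ubound_l1norm B :
  has_ubound [set l1norm (B *m u) | u in [set u : 'cV[R]_n | `|u| <= 1]].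
Proof.
exists (\sum_i \sum_j `|B i j|) => _ [u /= u1 <-].
apply: ler_sum => i _; rewrite mxE (le_trans (ler_norm_sum _ _ _)) //.
by apply: ler_sum => j _; rewrite normrM ler_piMr // normr_entry_le1.
Qed.

Lemma l1norm_le_opnorm B u : `|u| <= 1 -> l1norm (B *m u) <= opnorm_infty_1 B.
Proof. by move=> u1; apply: ub_le_sup; [exact: has_ubound_l1norm | exists u]. Qed.

(** The form is the sum of the u_i (B u)_i, and each |u_i| is at most 1. *)
Lemma quadratic_le_opnorm B u :
  `|u| <= 1 -> (u^T *m B *m u) 0 0 <= opnorm_infty_1 B.
Proof.
move=> u1; apply: le_trans (l1norm_le_opnorm B u u1).
rewrite -mulmxA mxE ler_sum // => i _; rewrite !mxE.
rewrite (le_trans (ler_norm _)) // normrM ler_piMl //.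
exact: normr_entry_le1.
Qed.

End cut_norm.

(** * Translation of order 3 matrices and Gram matrices into ternary forms *)

Section order3.
Context {R : realType}.

Definition col3 (u v w : R) : 'cV[R]_3 := \col_(i < 3) nth 0 [:: u; v; w] i.

Lemma quadratic_qform3 (B : 'M[R]_3) (u : 'cV[R]_3) : B^T = B ->
  (u^T *m B *m u) 0 0 =
  qform3 (B 0 0) (B 1 1) (B 2 2) (B 1 2) (B 0 2) (B 0 1) (u 0 0) (u 1 0) (u 2 0).
Proof.
move=> BT; have sym i j : B j i = B i j by rewrite -[in LHS]BT mxE.
rewrite -mulmxA mxE !big_ord3 !mxE !big_ord3 (sym 0 1) (sym 0 2) (sym 1 2).
rewrite /qform3; ring.
Qed.

Lemma normr_col3_le1 (u v w : R) :
  `|u| <= 1 -> `|v| <= 1 -> `|w| <= 1 -> `|col3 u v w| <= 1.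
Proof.
move=> u1 v1 w1; apply/cV_norm_leP => // i; rewrite mxE.
by case: i => [[|[|[|i]]] //= ?].
Qed.

Lemma sum_inner_trace3 (B : 'M[R]_3) (H : hilbertSpace R) (x : 'I_3 -> H) :
  B^T = B ->
  \sum_(i < 3) \sum_(j < 3) B i j * inner H (x i) (x j) =
  trace3 (B 0 0) (B 1 1) (B 2 2) (B 1 2) (B 0 2) (B 0 1)
    (inner H (x 0) (x 0)) (inner H (x 1) (x 1)) (inner H (x 2) (x 2))
    (inner H (x 1) (x 2)) (inner H (x 0) (x 2)) (inner H (x 0) (x 1)).
Proof.
move=> BT; have sym i j : B j i = B i j by rewrite -[in LHS]BT mxE.
have hC i j : inner H (x j) (x i) = inner H (x i) (x j).
  by rewrite hermC /= expr0 mul1r.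
rewrite !big_ord3 (sym 0 1) (sym 0 2) (sym 1 2) (hC 0 1) (hC 0 2) (hC 1 2).
rewrite /trace3; ring.
Qed.

(** The Gram form at (u, v, w) is the squared norm of u x + v y + w z. *)
Lemma psd3_gram (H : hilbertSpace R) (x y z : H) :
  psd3 (inner H x x) (inner H y y) (inner H z z)
    (inner H y z) (inner H x z) (inner H x y).
Proof.
move=> u v w; have := inner_norm (u *: x + v *: y + w *: z).
have hC (s t : H) : inner H t s = inner H s t by rewrite hermC /= expr0 mul1r.
rewrite !(linearDl, linearDr, linearZl_LR, linearZr_LR) /=.
rewrite (hC x y) (hC x z) (hC y z) => e.
have -> : qform3 (inner H x x) (inner H y y) (inner H z z)
    (inner H y z) (inner H x z) (inner H x y) u v w =
    `|u *: x + v *: y + w *: z| ^+ 2.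
  by rewrite -e /qform3 /GRing.scale /=; ring.
exact: sqr_ge0.
Qed.

End order3.

(** * The upper and lower bounds for the constant *)

Lemma KG_pos3_le (R : realType) : (KG_pos R 3 <= (9 / 8 : R)%:E)%E.
Proof.
apply: ge_ereal_sup => _ [B [H [x [[BT B0] B1 x1 ->]]]].
rewrite lee_fin sum_inner_trace3 //.
have psdB : psd3 (B 0 0) (B 1 1) (B 2 2) (B 1 2) (B 0 2) (B 0 1).
  by move=> u v w; have := B0 (col3 u v w); rewrite quadratic_qform3 // !mxE.
have cut u v w : `|u| <= 1 -> `|v| <= 1 -> `|w| <= 1 ->
    qform3 (B 0 0) (B 1 1) (B 2 2) (B 1 2) (B 0 2) (B 0 1) u v w <= 1.
  move=> u1 v1 w1; apply: le_trans B1.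
  have := quadratic_le_opnorm B _ (normr_col3_le1 _ _ _ u1 v1 w1).
  by rewrite quadratic_qform3 // !mxE.
have G := psd3_gram H (x 0) (x 1) (x 2).
rewrite ger0_norm; last exact: trace3_ge0.
have n1 i : inner H (x i) (x i) <= 1 by rewrite inner_norm expr_le1.
by apply: trace3_le => //; apply: cut; rewrite ?normrN normr1.
Qed.

Lemma KG_pos3_ge (R : realType) : ((9 / 8 : R)%:E <= KG_pos R 3)%E.
Proof.
pose B : 'M[R]_3 := \matrix_(i, j) (if i == j then 1 / 4 else - (1 / 8)).
(* The sine of 2 pi/3. *)
pose s : R := Num.sqrt (3 / 4).
have s2 : s * s = 3 / 4 by rewrite -expr2 sqr_sqrtr //; lra.
pose x (i : 'I_3) : @euclidean_plane R :=
  nth 0 [:: (1, 0); (- (1 / 2), s); (- (1 / 2), - s)] i.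
have dotE (i j : 'I_3) : inner euclidean_plane (x i) (x j) = if i == j then 1 else - (1 / 2).
  rewrite /inner /=.
  by case: i j => [[|[|[|i]]] //= ?] [[|[|[|j]]] //= ?]; rewrite /x /plane_dot /=; lra.
have BT : B^T = B by apply/matrixP => i j; rewrite !mxE eq_sym.
apply: ereal_sup_ubound; exists B, euclidean_plane, x; split.
- split => // u; rewrite quadratic_qform3 // /qform3 !mxE /=.
  (* The form of [B] is 1/8 of the sum of the squared differences of the coordinates. *)
  have := sqr_ge0 (u 0 0 - u 1 0); have := sqr_ge0 (u 0 0 - u 2 0).
  have := sqr_ge0 (u 1 0 - u 2 0); lra.
- apply: sup_le_ub; first by exists (l1norm (B *m 0)), 0; rewrite //= normr0.
  move=> _ [u /= u1 <-]; rewrite /l1norm big_ord3 !mxE !big_ord3 !mxE /=.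
  have := normr_entry_le1 _ 0 u1; have := normr_entry_le1 _ 1 u1.
  have := normr_entry_le1 _ 2 u1; rewrite !ler_norml => /andP[? ?] /andP[? ?] /andP[? ?].
  (* Once the signs of the three entries of B u are fixed, the l_1 norm is linear in u, and the
     bounds on the coordinates of u suffice. *)
  by do 3 (case: ler0P => _); lra.
- by move=> i; rewrite -(@expr_le1 _ 2) // -inner_norm dotE eqxx.
(* The diagonal contributes 3/4, and the six off-diagonal terms 1/16 each. *)
- congr EFin; rewrite !big_ord3 !dotE !mxE /=; rewrite ger0_norm; lra.
Qed.

Theorem theorem2p23 (R : realType) : KG_pos R 3 = (9 / 8 : R)%:E.
Proof. by apply/eqP; rewrite eq_le KG_pos3_le KG_pos3_ge. Qed.
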